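(* Let $n\ge1$ and let $\alpha,\beta\vDash n$ be compositions. 1. If $\mathrm{SIT}_{\mathfrak{S}^*}(\alpha;\beta)\ne\emptyset$, then $\beta\le_d\alpha$. 2. If $\mathrm{SRIT}_{\mathfrak{S}^*}(\alpha;\beta)\ne\emptyset$, then $\beta^r\le_d\alpha^r$. 3. If $\mathrm{SIT}_{R\mathfrak{S}^*}(\alpha;\beta)\ne\emptyset$, then $\beta^c\le_d\alpha$. 4. If $\mathrm{SRIT}_{R\mathfrak{S}^*}(\alpha;\beta)\ne\emptyset$, then $\beta^t\le_d\alpha^r$.
   Context: A composition $\alpha=(\alpha_1,\dots,\alpha_\ell)\vDash n$ is a finite list of positive integers with sum $n$; $\ell(\alpha)=\ell$. Write $\mathrm{Set}(\alpha)=\{\alpha_1,\alpha_1+\alpha_2,\dots,\alpha_1+\cdots+\alpha_{\ell-1}\}\subseteq[n-1]=\{1,\dots,n-1\}$, and let $\mathrm{Comp}$ be the inverse bijection from subsets of $[n-1]$ to compositions of $n$. The reverse is $\alpha^r=(\alpha_\ell,\dots,\alpha_1)$, the complement is $\alpha^c=\mathrm{Comp}([n-1]\setminus\mathrm{Set}(\alpha))$, and the transpose is $\alpha^t=(\alpha^c)^r=(\alpha^r)^c$. Dominance order: for $\alpha,\beta\vDash n$, $\beta\le_d\alpha$ if $\sum_{i=1}^k\beta_i\le\sum_{i=1}^k\alpha_i$ for all $1\le k\le\min\{\ell(\alpha),\ell(\beta)\}$. The diagram of $\alpha$ is the left-justified array of cells with $\alpha_i$ cells in row $i$, rows numbered from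 bottom to top. $\mathrm{SIT}(\alpha)$ (standard immaculate tableaux) is the set of bijective fillings of the diagram of $\alpha$ with $1,\dots,n$ such that entries increase from bottom to top in the first (leftmost) column and from left to right in each row. $\mathrm{SRIT}(\alpha)$ (standard reverse immaculate tableaux) is the set of bijective fillings with $1,\dots,n$ such that entries increase from bottom to top in the first (leftmost) column and from right to left in each row. For $T$ in either set, $\mathrm{Des}_{\mathfrak{S}^*}(T)=\{i\in[n-1]\mid i+1$ is in a strictly higher row than $i$ in $T\}$ and $\mathrm{Des}_{R\mathfrak{S}^*}(T)=\{i\in[n-1]\mid i+1$ is in the same row as or a lower row than $i$ in $T\}$. For $\ast\in\{\mathfrak{S}^*,R\mathfrak{S}^*\}$, the $\ast$-descent composition of $T$ is $\mathrm{Comp}(\mathrm{Des}_\ast(T))$, and $\mathrm{SIT}_\ast(\alpha;\beta)$ (resp. $\mathrm{SRIT}_\ast(\alpha;\beta)$) is the set of $T\in\mathrm{SIT}(\alpha)$ (resp. $T\in\mathrm{SRIT}(\alpha)$) with $\ast$-descent composition $\beta$. *)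

(* Defs.v *)
From mathcomp Require Import all_boot.

Set Implicit Arguments.
Unset Strict Implicit.
Unset Printing Implicit Defensive.

Definition composition (n : nat) (a : seq nat) : bool :=
  all (leq 1) a && (sumn a == n).

(* Set(a). Subsets of [n-1] are otherwise given as predicates on nat. *)
Definition comp_set (a : seq nat) : seq nat :=
  [seq sumn (take k a) | k <- iota 1 (size a).-1].

(* Successive differences of 0 < s_1 < ... < s_m < n, where s_1, ..., s_m are
   the elements of S in [n-1]; meaningful only for n > 0.  See comp_set_comp_of
   and comp_of_comp_set for the fact that this inverts comp_set. *)
Definition comp_of (n : nat) (S : pred nat) : seq nat :=
  pairmap (fun x y => y - x) 0 (rcons [seq i <- iota 1 n.-1 | S i] n).

Definition comp_compl (a : seq nat) : seq nat :=
  comp_of (sumn a) [pred i | i \notin comp_set a].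

Definition comp_transpose (a : seq nat) : seq nat := rev (comp_compl a).

(* domle b a is b <=_d a. *)
Definition domle (b a : seq nat) : Prop :=
  forall k, 1 <= k <= minn (size a) (size b) ->
    sumn (take k b) <= sumn (take k a).

(* A filling of the diagram of a is its sequence of rows from bottom to top,
   each row being read from left to right. *)
Definition filling : Type := seq (seq nat).

Definition standard_filling (a : seq nat) (T : filling) : bool :=
  (shape T == a) && perm_eq (flatten T) (iota 1 (sumn a)).

Definition first_column (T : filling) : seq nat := [seq head 0 r | r <- T].

Definition SIT (a : seq nat) : pred filling :=
  [pred T | [&& standard_filling a T, sorted ltn (first_column T)
              & all (sorted ltn) T]].

Definition SRIT (a : seq nat) : pred filling :=
  [pred T | [&& standard_filling a T, sorted ltn (first_column T)
              & all (sorted gtn) T]].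

(* Index, counted from 0 at the bottom, of the row containing the entry i. *)
Definition row_of (T : filling) (i : nat) : nat :=
  find (fun r : seq nat => i \in r) T.

Definition Des_S (n : nat) (T : filling) : pred nat :=
  [pred i | (1 <= i <= n.-1) && (row_of T i < row_of T i.+1)].

Definition Des_RS (n : nat) (T : filling) : pred nat :=
  [pred i | (1 <= i <= n.-1) && (row_of T i.+1 <= row_of T i)].

Definition SIT_S (a b : seq nat) : pred filling :=
  [pred T | (T \in SIT a) && (comp_of (sumn a) (Des_S (sumn a) T) == b)].

Definition SRIT_S (a b : seq nat) : pred filling :=
  [pred T | (T \in SRIT a) && (comp_of (sumn a) (Des_S (sumn a) T) == b)].

Definition SIT_RS (a b : seq nat) : pred filling :=
  [pred T | (T \in SIT a) && (comp_of (sumn a) (Des_RS (sumn a) T) == b)].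

Definition SRIT_RS (a b : seq nat) : pred filling :=
  [pred T | (T \in SRIT a) && (comp_of (sumn a) (Des_RS (sumn a) T) == b)].

Lemma scanl_addnE x a :
  scanl addn x a = [seq x + sumn (take k a) | k <- iota 1 (size a)].
Proof.
elim: a x => //= y a IHa x; rewrite take0 /= addn0; congr (_ :: _).
rewrite IHa (iotaDl 1 1) -map_comp; apply: eq_map => k /=.
by rewrite addnA.
Qed.

Lemma rcons_comp_set a : a != [::] ->
  rcons (comp_set a) (sumn a) = scanl addn 0 a.
Proof.
case: a => // y a _; rewrite scanl_addnE /comp_set.
have -> : iota 1 (size (y :: a)) = rcons (iota 1 (size a)) (size (y :: a)).
  by rewrite -cats1 -[X in iota 1 X]addn1 iotaD.
by rewrite map_rcons take_size.
Qed.

Lemma pairmap_subnK x s : path leq x s ->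
  scanl addn x (pairmap (fun y z => z - y) x s) = s.
Proof.
by elim: s x => //= y s IHs x /andP[lexy /IHs]; rewrite subnKC // => ->.
Qed.

Lemma path_ltn_scanl x a : all (leq 1) a -> path ltn x (scanl addn x a).
Proof.
elim: a x => //= y a IHa x /andP[y0 /IHa ->].
by rewrite -[X in X < _]addn0 ltn_add2l y0.
Qed.

Lemma path_ltn_pairmap x s : path ltn x s ->
  all (leq 1) (pairmap (fun y z => z - y) x s).
Proof.
by elim: s x => //= y s IHs x /andP[ltxy /IHs ->]; rewrite subn_gt0 ltxy.
Qed.

Lemma path_filter_rcons n S : 0 < n ->
  path ltn 0 (rcons [seq i <- iota 1 n.-1 | S i] n).
Proof.
move=> n0; have srt : path ltn 0 [seq i <- iota 1 n.-1 | S i].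
  apply: (@path_filter _ ltn ltn_trans) => //.
  by rewrite -[path _ _ _]/(sorted ltn (iota 0 n.-1.+1)) iota_ltn_sorted.
rewrite rcons_path srt /=.
have := mem_last 0 [seq i <- iota 1 n.-1 | S i].
rewrite inE => /orP[/eqP -> //|].
by rewrite mem_filter mem_iota add1n prednK // => /and3P[].
Qed.

Lemma comp_of_neq0 n S : comp_of n S != [::].
Proof. by rewrite /comp_of -size_eq0 size_pairmap size_rcons. Qed.

Lemma rcons_comp_set_comp_of n S : 0 < n ->
  rcons (comp_set (comp_of n S)) (sumn (comp_of n S)) =
  rcons [seq i <- iota 1 n.-1 | S i] n.
Proof.
move=> n0; rewrite rcons_comp_set ?comp_of_neq0 //.
apply: pairmap_subnK; apply: sub_path (path_filter_rcons S n0).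
exact: ltnW.
Qed.

Lemma composition_comp_of n S : 0 < n -> composition n (comp_of n S).
Proof.
move=> n0; rewrite /composition path_ltn_pairmap ?path_filter_rcons //=.
by have /rcons_inj[_ ->] := rcons_comp_set_comp_of S n0.
Qed.

Lemma comp_set_comp_of n S i : 0 < n ->
  (i \in comp_set (comp_of n S)) = (1 <= i <= n.-1) && S i.
Proof.
move=> n0; have /rcons_inj[-> _] := rcons_comp_set_comp_of S n0.
by rewrite mem_filter mem_iota andbC add1n ltnS.
Qed.

Lemma comp_of_comp_set n a : 0 < n -> composition n a ->
  comp_of n [in comp_set a] = a.
Proof.
move=> n0 /andP[a0 /eqP an].
have aN : a != [::] by apply: contraTneq n0 => a_nil; rewrite -an a_nil.
have pth : path ltn 0 (rcons (comp_set a) n).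
  by rewrite -an rcons_comp_set // path_ltn_scanl.
have E : [seq i <- iota 1 n.-1 | i \in comp_set a] = comp_set a.
  have /andP[pth0 _] : path ltn 0 (comp_set a) && (last 0 (comp_set a) < n).
    by rewrite -rcons_path.
  apply: (irr_sorted_eq ltn_trans ltnn).
  - by apply: sorted_filter (iota_ltn_sorted _ _); apply: ltn_trans.
  - exact: path_sorted pth0.
  move=> i; rewrite mem_filter mem_iota andb_idr // => ia.
  have /allP/(_ _ ia) /= -> := order_path_min ltn_trans pth0.
  move: (path_sorted pth); rewrite -[rcons _ _]revK rev_rcons rev_sorted /=.
  move=> /(order_path_min (fun _ _ _ h k => ltn_trans k h)) /allP/(_ i).
  by rewrite mem_rev add1n prednK //; apply.
by rewrite /comp_of E -an rcons_comp_set // scanlK // => x y; rewrite addKn.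
Qed.

(* Main.v *)
Require Import Defs.
From mathcomp Require Import all_boot.
From mathcomp Require Import zify.

Set Implicit Arguments.
Unset Strict Implicit.
Unset Printing Implicit Defensive.

(** Everything reduces to the first claim, which rests on one inequality: in a
standard immaculate tableau [T], the entry [i] lies in a row whose index
(from 0) is at most the number of descents smaller than [i]
([row_of_le_descents]).  Rows and first column increase, so the least entry of
each row below the one of [i] precedes [i]; hence, reading 1, 2, 3, ..., no
row is entered before all the rows under it have been, and every entry into a
row higher than all the previous ones is made at a descent.  The sum of the
first [k] parts of the descent composition is preceded by at most [k - 1]
descents, so all entries up to that sum lie in the first [k] rows, which have
only [alpha_1 + ... + alpha_k] cells: this is dominance ([SIT_domle]).

The other claims follow by two symmetries.  The two descent sets of a filling
are complementary in [{1, ..., n-1}], which turns the third and fourth claims into the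
first and second ([comp_compl_Des_RS]).  Replacing each entry [x] by
[n + 1 - x] and turning the diagram upside down carries reverse immaculate
tableaux of shape [alpha] to immaculate tableaux of shape [rev alpha], and
reverses the descent composition ([flip_SIT], [comp_of_Des_S_flip]), which
turns the second claim into the first. *)

(** * Compositions *)

Lemma eq_in_comp_of n (S1 S2 : pred nat) :
  (forall i, 1 <= i <= n.-1 -> S1 i = S2 i) -> comp_of n S1 = comp_of n S2.
Proof.
move=> eqS; rewrite /comp_of; congr (pairmap _ _ (rcons _ _)).
by apply: eq_in_filter => i; rewrite mem_iota add1n ltnS => /eqS.
Qed.

Lemma leq_sumn_take (b : seq nat) m k :
  m <= k -> sumn (take m b) <= sumn (take k b).
Proof.
by move=> lemk; rewrite -(subnKC lemk) takeD sumn_cat leq_addr.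
Qed.

(** The elements of [comp_set b] are the partial sums of [b], so those smaller
than the [k]-th one come from indices below [k]. *)
Lemma count_comp_set_lt (b : seq nat) k :
  count [in comp_set b] (iota 1 (sumn (take k b)).-1) <= k.-1.
Proof.
rewrite -size_filter -(size_iota 1 k.-1).
rewrite -(size_map (fun m => sumn (take m b))).
apply: uniq_leq_size => [|i]; first by rewrite filter_uniq ?iota_uniq.
rewrite mem_filter mem_iota => /andP[/mapP[m]]; rewrite mem_iota => m_b -> lts.
apply: map_f; rewrite mem_iota; case: (ltnP m k) => [|/(leq_sumn_take b)]; lia.
Qed.

Lemma mem_comp_set_rev a i : i <= sumn a ->
  (i \in comp_set (rev a)) = (sumn a - i \in comp_set a).
Proof.
have sub b j : j \in comp_set b -> sumn b - j \in comp_set (rev b).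
  move=> /mapP[m]; rewrite mem_iota => m_b ->.
  apply/mapP; exists (size b - m); first by rewrite mem_iota size_rev; lia.
  rewrite take_rev sumn_rev subKn; last by lia.
  by rewrite -{1}(cat_take_drop m b) sumn_cat addKn.
move=> le_i; apply/idP/idP => [/sub|/sub]; first by rewrite revK sumn_rev.
by rewrite subKn.
Qed.

Lemma rev_comp_of n S : 0 < n ->
  rev (comp_of n S) = comp_of n [pred i | S (n - i)].
Proof.
move=> n0; have /andP[a0 /eqP an] := composition_comp_of S n0.
have /(comp_of_comp_set n0) <- : composition n (rev (comp_of n S)).
  by rewrite /composition all_rev a0 sumn_rev an eqxx.
apply: eq_in_comp_of => i i_n /=.
rewrite mem_comp_set_rev an ?comp_set_comp_of //; last by lia.
by rewrite andb_idl //; lia.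
Qed.

(** * Rows of a standard filling *)

Lemma standard_mem a T i : standard_filling a T ->
  (i \in flatten T) = (1 <= i <= sumn a).
Proof. by case/andP=> _ /perm_mem ->; rewrite mem_iota add1n ltnS. Qed.

Lemma standard_uniq a T : standard_filling a T -> uniq (flatten T).
Proof. by case/andP=> _ /perm_uniq ->; exact: iota_uniq. Qed.

Lemma standard_row_neq0 a T r : all (leq 1) a -> standard_filling a T ->
  r \in T -> r != [::].
Proof.
move=> a0 /andP[/eqP shT _] rT; rewrite -size_eq0 -lt0n.
by apply: (allP a0); rewrite -shT; apply: map_f.
Qed.

Lemma mem_nth_flatten (T : filling) m x :
  x \in nth [::] T m -> x \in flatten T.
Proof.
case: (ltnP m (size T)) => [lt_m xm|/(nth_default [::]) -> //].
by apply/flattenP; exists (nth [::] T m); rewrite ?mem_nth.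
Qed.

Lemma row_of_lt (T : filling) i : i \in flatten T -> row_of T i < size T.
Proof. by move=> /flattenP[r rT ir]; rewrite -has_find; apply/hasP; exists r. Qed.

Lemma mem_row_of (T : filling) i :
  i \in flatten T -> i \in nth [::] T (row_of T i).
Proof.
move=> /row_of_lt; rewrite -has_find; exact: (@nth_find _ [::] (fun r => i \in r)).
Qed.

Lemma row_of_unique (T : filling) m i :
  uniq (flatten T) -> i \in nth [::] T m -> row_of T i = m.
Proof.
elim: T m => [|r T IHT] m; first by rewrite nth_nil.
rewrite /row_of /= cat_uniq => /and3P[_ /hasPn disj uT].
case: m => [-> //|m /= im].
rewrite (negbTE (disj _ (mem_nth_flatten im))).
by rewrite -[find _ _]/(row_of T i) (IHT m).
Qed.

(** * Immaculate tableaux *)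

Lemma head_sorted_le r x : sorted ltn r -> x \in r -> head 0 r <= x.
Proof.
case: r => //= y r /(order_path_min ltn_trans)/allP min_y.
by rewrite inE => /predU1P[->|/min_y /ltnW].
Qed.

(** The witness is the leftmost, hence least, entry of row [m]. *)
Lemma lower_row_entry a T i m : all (leq 1) a -> T \in SIT a ->
  1 <= i <= sumn a -> m < row_of T i ->
  exists2 x, row_of T x = m & 1 <= x < i.
Proof.
move=> a0 /and3P[stT srt_col /allP srt_row]; rewrite -(standard_mem _ stT) => iT lt_m.
have lt_i := row_of_lt iT; have lt_mT := ltn_trans lt_m lt_i.
have x_m : head 0 (nth [::] T m) \in nth [::] T m.
  have := standard_row_neq0 a0 stT (mem_nth [::] lt_mT).
  by case: (nth _ _ _) => //= x r _; rewrite mem_head.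
exists (head 0 (nth [::] T m)).
  exact: row_of_unique (standard_uniq stT) x_m.
have := mem_nth_flatten x_m; rewrite (standard_mem _ stT) => /andP[-> _] /=.
have le_i := head_sorted_le (srt_row _ (mem_nth [::] lt_i)) (mem_row_of iT).
apply: leq_trans le_i.
have := sorted_ltn_nth ltn_trans 0 srt_col; rewrite /first_column.
move=> /(_ m (row_of T i)); rewrite !inE size_map => /(_ lt_mT lt_i lt_m).
by rewrite !(nth_map [::]).
Qed.

(** At a descent [i - 1], the row just under that of [i] already contains some
[x < i], and the induction hypothesis applies to [x] rather than to [i - 1]:
a descent may jump over several rows. *)
Lemma row_of_le_descents a T i : all (leq 1) a -> T \in SIT a ->
  1 <= i <= sumn a ->
  row_of T i <= count (Des_S (sumn a) T) (iota 1 i.-1).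
Proof.
move=> a0 TS; elim/ltn_ind: i => i IHi i_n.
case row_i: (row_of T i) => [//|m].
have [|x row_x /andP[x0 lt_x]] := @lower_row_entry a T i m a0 TS i_n.
  by rewrite row_i.
case: i => [|[|i]] // in IHi i_n row_i lt_x *; first by lia.
have -> : i.+2.-1 = i + 1 by rewrite addn1.
rewrite iotaD count_cat add1n [X in _ + X]/= addn0.
have [desc|ndesc] := boolP (Des_S (sumn a) T i.+1).
  have := IHi x lt_x; rewrite row_x => /(_ ltac:(lia)) le_m.
  (* Descents below [x] are among those below [i.+1]. *)
  have -> : i = x.-1 + (i - x.-1) by lia.
  by rewrite iotaD count_cat; lia.
have := IHi i.+1 (ltnSn _) ltac:(lia).
by move: ndesc; rewrite /Des_S /= row_i; lia.
Qed.

Lemma SIT_domle a T : all (leq 1) a -> 0 < sumn a -> T \in SIT a ->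
  domle (comp_of (sumn a) (Des_S (sumn a) T)) a.
Proof.
move=> a0 n0 TS k; have /and3P[stT _ _] := TS.
set b := comp_of _ _ => /andP[k0 _].
have /andP[_ /eqP b_n] : composition (sumn a) b by exact: composition_comp_of.
have sz : size (flatten (take k T)) = sumn (take k a).
  by case/andP: stT => /eqP shT _; rewrite size_flatten -shT /shape map_take.
rewrite -sz -{1}(size_iota 1 (sumn (take k b))).
apply: uniq_leq_size; first exact: iota_uniq.
move=> i; rewrite mem_iota => i_s.
have le_n : sumn (take k b) <= sumn a.
  by rewrite -b_n -{2}(cat_take_drop k b) sumn_cat leq_addr.
have i_n : 1 <= i <= sumn a by lia.
have iT : i \in flatten T by rewrite (standard_mem _ stT).
have lt_k : row_of T i < k.
  have le_row := @row_of_le_descents a T i a0 TS i_n.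
  have le_k := count_comp_set_lt b k.
  have eq_des : count (Des_S (sumn a) T) (iota 1 i.-1)
              = count [in comp_set b] (iota 1 i.-1).
    apply: eq_in_count => j; rewrite mem_iota => j_i.
    by rewrite /= comp_set_comp_of //= andbA andbb.
  move: le_k; have -> : (sumn (take k b)).-1 = i.-1 + (sumn (take k b) - i).
    by lia.
  by rewrite iotaD count_cat; lia.
apply: (@mem_nth_flatten _ (row_of T i)).
by rewrite nth_take // mem_row_of.
Qed.

(** * Symmetries *)

Lemma comp_compl_Des_RS n T : 0 < n ->
  comp_compl (comp_of n (Des_RS n T)) = comp_of n (Des_S n T).
Proof.
move=> n0; have /andP[_ /eqP an] := composition_comp_of (Des_RS n T) n0.
rewrite /comp_compl an; apply: eq_in_comp_of => i i_n.
by rewrite /= comp_set_comp_of // /Des_S /Des_RS /= i_n /= ltnNge.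
Qed.

Definition flip n (T : filling) : filling :=
  rev [seq [seq n.+1 - x | x <- r] | r <- T].

Lemma flip_standard a T : standard_filling a T ->
  standard_filling (rev a) (flip (sumn a) T).
Proof.
move=> stT; have /andP[/eqP shT pT] := stT.
apply/andP; split.
  apply/eqP; rewrite /flip /shape map_rev -map_comp -[in rev a]shT; congr rev.
  by apply: eq_map => r /=; rewrite size_map.
have inj : {in [pred x | x <= sumn a] &, injective (subn (sumn a).+1)}.
  by move=> x y; rewrite !inE; lia.
have pf : perm_eq (flatten (flip (sumn a) T)) [seq (sumn a).+1 - x | x <- flatten T].
  by rewrite map_flatten /flip perm_flatten // perm_rev.
apply: uniq_perm; last 1 first.
- move=> x; rewrite (perm_mem pf) sumn_rev mem_iota.
  apply/mapP/idP => [[y]|x_n]; first by rewrite (standard_mem _ stT); lia.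
  by exists ((sumn a).+1 - x); [rewrite (standard_mem _ stT)|]; lia.
- rewrite (perm_uniq pf) map_inj_in_uniq ?(standard_uniq stT) // => x y.
  by rewrite !(standard_mem _ stT) => *; apply: inj; rewrite ?inE; lia.
exact: iota_uniq.
Qed.

Lemma flip_SIT a T : all (leq 1) a -> T \in SRIT a ->
  flip (sumn a) T \in SIT (rev a).
Proof.
move=> a0 /and3P[stT srt_col /allP srt_row].
have le_n r x : r \in T -> x \in r -> x <= sumn a.
  move=> rT xr; have : x \in flatten T by apply/flattenP; exists r.
  by rewrite (standard_mem _ stT) => /andP[].
have anti : {in [pred x | x <= sumn a] &,
    {homo subn (sumn a).+1 : x y / x > y >-> x < y}}.
  by move=> x y; rewrite !inE; lia.
apply/and3P; split; first exact: flip_standard.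
  have -> : first_column (flip (sumn a) T)
          = rev [seq (sumn a).+1 - x | x <- first_column T].
    rewrite /first_column /flip map_rev -!map_comp; congr rev.
    apply/eq_in_map => r /(standard_row_neq0 a0 stT).
    by case: r.
  rewrite rev_sorted.
  apply: (@homo_sorted_in _ _ [pred x | x <= sumn a] _ ltn) srt_col.
    by move=> x y x_n y_n; apply: anti.
  apply/allP=> _ /mapP[r rT ->].
  by case: r rT => //= x r rT; apply: le_n rT _; rewrite mem_head.
rewrite all_rev; apply/allP=> _ /mapP[r rT ->].
apply: (@homo_sorted_in _ _ [pred x | x <= sumn a] _ gtn) (srt_row _ rT) => //.
by apply/allP=> x; apply: le_n.
Qed.

Lemma row_of_flip a T i : standard_filling a T -> 1 <= i <= sumn a ->
  row_of (flip (sumn a) T) i = size T - (row_of T ((sumn a).+1 - i)).+1.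
Proof.
move=> stT i_n; set j := _.+1 - i.
have jT : j \in flatten T by rewrite (standard_mem _ stT); lia.
have lt_j := row_of_lt jT.
apply: row_of_unique; first exact: standard_uniq (flip_standard stT).
rewrite /flip nth_rev size_map; last by lia.
have -> : size T - (size T - (row_of T j).+1).+1 = row_of T j by lia.
rewrite (nth_map [::]) //; apply/mapP; exists j; first exact: mem_row_of.
by lia.
Qed.

Lemma comp_of_Des_S_flip a T : 0 < sumn a -> standard_filling a T ->
  comp_of (sumn a) (Des_S (sumn a) (flip (sumn a) T))
  = rev (comp_of (sumn a) (Des_S (sumn a) T)).
Proof.
move=> n0 stT; rewrite rev_comp_of //; apply: eq_in_comp_of => i i_n.
rewrite /Des_S /= !(@row_of_flip a) //; try by lia.
have row_lt j : 1 <= j <= sumn a -> row_of T j < size T.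
  by rewrite -(standard_mem _ stT); apply: row_of_lt.
have := row_lt (sumn a - i) ltac:(lia).
have := row_lt (sumn a - i).+1 ltac:(lia).
by rewrite subSS subSn; lia.
Qed.

Lemma SRIT_domle a T : all (leq 1) a -> 0 < sumn a -> T \in SRIT a ->
  domle (rev (comp_of (sumn a) (Des_S (sumn a) T))) (rev a).
Proof.
move=> a0 n0 TS; have /and3P[stT _ _] := TS.
rewrite -comp_of_Des_S_flip // -(sumn_rev a).
by apply: SIT_domle; rewrite ?all_rev ?sumn_rev ?flip_SIT.
Qed.

Theorem corollary6p4 (n : nat) (alpha beta : seq nat)
    (hn : 1 <= n) (halpha : composition n alpha) (hbeta : composition n beta) :
  [/\ (exists T, T \in SIT_S alpha beta) -> domle beta alpha,
      (exists T, T \in SRIT_S alpha beta) -> domle (rev beta) (rev alpha),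
      (exists T, T \in SIT_RS alpha beta) -> domle (comp_compl beta) alpha
    & (exists T, T \in SRIT_RS alpha beta) ->
        domle (comp_transpose beta) (rev alpha)].
Proof.
case/andP: halpha => a0 /eqP an; have n0 : 0 < sumn alpha by rewrite an.
split=> -[T /andP[TS /eqP <-]].
- exact: SIT_domle.
- exact: SRIT_domle.
- by rewrite comp_compl_Des_RS //; apply: SIT_domle.
- by rewrite /comp_transpose comp_compl_Des_RS //; apply: SRIT_domle.
Qed.
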